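(* Let $S$ be a numerical semigroup with some nonzero $a\in S$, let $m$ be a positive integer, and suppose $\mathrm{Ap}(S;a)\setminus\{0\}$ is an arithmetic sequence consisting of at least one term. Then $S=\langle \{a\}\cup\{ha+id:1\le i\le a-1\}\rangle$ for some integers $a\ge2$, $h\ge0$, $d\ge1$ with $\gcd(a,d)=1$ (where, if $a=2$, one takes $h=0$ and $d$ odd). Moreover, $\mathrm{H}(S)$ is equidistributed modulo $m$ if and only if $\gcd(ad,m)=1$ and at least one of the following occurs: (1) $a\equiv1\pmod m$; or (2) $a\equiv2\pmod m$ and $2h+d\equiv1\pmod m$; or (3) $d\equiv1\pmod m$ and $h\equiv0\pmod m$; or (4) $d\equiv-1\pmod m$ and $h\equiv1\pmod m$.
   Context: A numerical semigroup is a submonoid $S$ of $(\mathbb{N}_0,+)$ with finite complement; $\mathrm{H}(S)=\mathbb{N}_0\setminus S$ is its set of gaps. For $G\subset\mathbb{N}_0$, $\langle G\rangle$ is the set of all finite $\mathbb{N}_0$-linear combinations of elements of $G$. For nonzero $a\in S$, the Apéry set is $\mathrm{Ap}(S;a)=\{s\in S: s-a\notin S\}$; it has exactly $a$ elements. ''$\mathrm{Ap}(S;a)\setminus\{0\}$ is an arithmetic sequence'' means that this set equals $\{\beta+\delta,\beta+2\delta,\dots,\beta+(a-1)\delta\}$ for some $\beta\in\mathbb{Z}$ and some positive integer $\delta$; when $a=2$ the convention is $\beta=0$ and $\delta$ odd. The parameters in the representation of $S$ correspond to $\beta=ha$ and $\delta=d$. A finite (multi)set of integers is equidistributed modulo $m$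 if it contains the same number of elements in each congruence class modulo $m$.
   Formalization: The equivalence is stated only when H(S) is nonempty (S ≠ N_0): for S = N_0, a = 2, h = 0, d = 1, m = 2, the empty set H(S) is equidistributed modulo 2 although gcd(ad, m) = 2. *)

(* Defs.v *)
From HB Require Import structures.
From mathcomp Require Import all_boot all_order all_algebra.
From mathcomp Require Import all_classical.

Set Implicit Arguments.
Unset Strict Implicit.
Unset Printing Implicit Defensive.

Import Order.TTheory GRing.Theory Num.Theory.

Local Open Scope classical_set_scope.
Local Open Scope card_scope.
Local Open Scope nat_scope.

Definition gaps (S : set nat) : set nat := ~` S.

Definition numerical_semigroup (S : set nat) : Prop :=
  [/\ S 0, forall x y, S x -> S y -> S (x + y) & finite_set (gaps S)].

(* A finite linear combination is a list of pairs (coefficient, generator). *)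
Definition semigroup_gen (G : set nat) : set nat :=
  [set n | exists s : seq (nat * nat),
     (forall p, p \in s -> G p.2) /\ n = \sum_(p <- s) p.1 * p.2].

(* The difference s - a is taken in the integers, so it is outside S as soon
   as s < a; hence the guard against truncated subtraction. *)
Definition Apery (S : set nat) (a : nat) : set nat :=
  [set s | S s /\ ~ (a <= s /\ S (s - a))].

(* Ap(S; a) \ {0} = {beta + delta, ..., beta + (a - 1) delta} as sets of
   integers.  For a = 2 the set has a single term, which does not determine
   beta and delta; the convention is then beta = 0 and delta odd. *)
Definition Apery_arithmetic (S : set nat) (a : nat) (beta : int) (delta : nat)
    : Prop :=
  [/\ 1 <= delta,
      a = 2 -> beta = 0%R /\ odd delta
    & [set Posz s | s in Apery S a `\ 0] =
      [set (beta + Posz (i * delta))%R | i in [set i | 1 <= i <= a - 1]]].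

Definition representation (S : set nat) (a h d : nat) : Prop :=
  [/\ 2 <= a, 1 <= d, coprime a d,
      a = 2 -> h = 0 /\ odd d
    & S = semigroup_gen
            ([set a] `|` [set h * a + i * d | i in [set i | 1 <= i <= a - 1]])].

(* [#=] is equality of cardinals; the sets compared are finite when A is. *)
Definition equidistributed (m : nat) (A : set nat) : Prop :=
  forall r s : nat,
    A `&` [set n | n = r %[mod m]] #= A `&` [set n | n = s %[mod m]].

(* Main.v *)
(* Write w_0 = 0 and w_i = h a + i d for 0 < i < a.  These are the Apery
   elements of S, one in each class modulo a, so the gaps are the numbers
   (w_i mod a) + j a with j < floor(w_i / a), and telescoping along j gives, for
   every function f,
     sum over gaps n of (f n - f (n + a)) = sum_(i < a) f i - sum_(i < a) f w_i.
   When gcd(a, m) = 1, testing against indicators of residue classes shows that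
   the gaps are equidistributed iff {w_i} and {0, .., a - 1} agree as multisets
   modulo m.  This forces gcd(d, m) = 1, and applying the differences with steps
   1 and d, which are injective on functions of sum zero, turns the condition
   into the equality modulo m of
     {1, a + d, ha + d + 1, ha + ad}  and  {a, d + 1, ha + d, ha + ad + 1}.
   Locating 1 in the second multiset gives the four cases.

   If g = gcd(a, m) > 1, equidistribution makes the gaps n with g | n as
   numerous as those with g | n + d.  With k_i = floor(w_i / a), Abel summation
   shows that k_i = k_(i-1) unless g | i.  Hence h = 0 and d < a, and d > 1 as
   there are gaps; but then k_i = floor(i d / a) jumps at i = q + 1 and at
   i = a - q with q = floor(a / d), so g divides both, hence also a + 1. *)

Require Import Defs.
From mathcomp Require Import all_boot all_order all_algebra.
From mathcomp Require Import all_classical finmap.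
From mathcomp Require Import zify ring.

Set Implicit Arguments.
Unset Strict Implicit.
Unset Printing Implicit Defensive.

Import GRing.Theory.

Local Open Scope classical_set_scope.
Local Open Scope nat_scope.

(** * The semigroup as a union of residue classes *)

Definition apery_term (a h d i : nat) : nat :=
  if i == 0 then 0 else h * a + i * d.

Definition apery_span (a h d : nat) : set nat :=
  [set n | exists i k, i < a /\ n = apery_term a h d i + k * a].

Lemma eqmod_le_addM (a m n : nat) :
  m <= n -> n = m %[mod a] -> exists k, n = m + k * a.
Proof.
move=> le_mn /eqP; rewrite eqn_mod_dvd // => /dvdnP[k Dk].
by exists k; rewrite -Dk subnKC.
Qed.

Lemma apery_term_mod (a h d i : nat) : apery_term a h d i = i * d %[mod a].
Proof. by rewrite /apery_term; case: eqP => [->|_] //; rewrite modnMDl. Qed.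

Lemma apery_term_modI (a h d i j : nat) : coprime a d -> i < a -> j < a ->
  apery_term a h d i = apery_term a h d j %[mod a] -> i = j.
Proof.
move=> cad; wlog le_ji : i j / j <= i => [hw lti ltj E|].
  by case/orP: (leq_total i j) => ?; [apply/esym|]; apply: hw.
move=> lti ltj; rewrite !apery_term_mod => /eqP.
rewrite eqn_mod_dvd ?leq_mul2r ?le_ji ?orbT // -mulnBl Gauss_dvdl //.
by move=> /dvdn_leq h1; apply/eqP; rewrite eqn_leq le_ji andbT; lia.
Qed.

Lemma apery_term_residues (a h d : nat) : coprime a d ->
  perm_eq [seq apery_term a h d i %% a | i <- iota 0 a] (iota 0 a).
Proof.
move=> cad; have u1 : uniq [seq apery_term a h d i %% a | i <- iota 0 a].
  rewrite map_inj_in_uniq ?iota_uniq // => i j; rewrite !mem_iota /= add0n.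
  exact: apery_term_modI.
apply: uniq_perm; rewrite ?iota_uniq //.
apply: (uniq_min_size u1 _ _).2; last by rewrite size_map.
by move=> x /mapP[i]; rewrite !mem_iota /= add0n => ? ->; rewrite ltn_pmod; lia.
Qed.

Lemma apery_term_surj (a h d n : nat) : coprime a d -> 0 < a ->
  exists2 i, i < a & apery_term a h d i = n %[mod a].
Proof.
move=> cad a0; have : n %% a \in iota 0 a by rewrite mem_iota ltn_pmod.
rewrite -(perm_mem (apery_term_residues h cad)) => /mapP[i].
by rewrite mem_iota => /= ? E; exists i.
Qed.

(** For nonzero indices the sum is 2ha + (i + j)d. Lowering the index by [a] trades [a * d] for [d]
    copies of [a]. The surplus of copies is [h], [h + d], or [2 * h + d] when the index drops to 0,
    whose term has no summand [h * a]. *)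
Lemma apery_termD (a h d i j : nat) : i < a -> j < a ->
  apery_span a h d (apery_term a h d i + apery_term a h d j).
Proof.
move=> lti ltj; rewrite /apery_term; case: eqP => [_|i0].
  by exists j, 0; rewrite ltj /apery_term mul0n addn0.
case: eqP => [_|j0].
  by exists i, 0; rewrite lti /apery_term mul0n (introF eqP i0).
case: (ltngtP (i + j) a) => ija.
- exists (i + j), h; rewrite /apery_term ija; case: eqP => [|_]; first lia.
  by split=> //; ring.
- exists (i + j - a), (h + d); split; first lia.
  rewrite /apery_term; case: eqP => [|_]; first lia.
  have -> : h * a + i * d + (h * a + j * d) = h * a + h * a + (i + j) * d
    by ring.
  rewrite -{1}(subnK (ltnW ija)); ring.
- exists 0, (2 * h + d); split; first lia.
  have -> : h * a + i * d + (h * a + j * d) = h * a + h * a + (i + j) * d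
    by ring.
  by rewrite /apery_term ija /=; ring.
Qed.

Lemma apery_spanD (a h d m n : nat) :
  apery_span a h d m -> apery_span a h d n -> apery_span a h d (m + n).
Proof.
move=> [i [k [lti ->]]] [j [l [ltj ->]]].
have [p [q [ltp E]]] := apery_termD h d lti ltj.
by exists p, (q + k + l); split=> //; rewrite !mulnDl !addnA -E; ring.
Qed.

Lemma apery_spanM (a h d c n : nat) : 0 < a ->
  apery_span a h d n -> apery_span a h d (c * n).
Proof.
move=> a0 Sn; elim: c => [|c IHc]; first by exists 0, 0.
by rewrite mulSn; exact: apery_spanD.
Qed.

Lemma semigroup_gen_apery (a h d : nat) : 2 <= a ->
  semigroup_gen
    ([set a] `|` [set h * a + i * d | i in [set i | 1 <= i <= a - 1]]) =
  apery_span a h d.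
Proof.
move=> a2; apply/seteqP; split=> n /=.
  case=> s [Gs ->] {n}; elim: s Gs => [|p s IHs] Gs.
    by rewrite big_nil; exists 0, 0; split=> //; lia.
  rewrite big_cons; apply: apery_spanD; last first.
    by apply: IHs => q qs; apply: Gs; rewrite inE qs orbT.
  apply: apery_spanM; first lia.
  case: (Gs p (mem_head _ _)) => [->|[i /= hi <-]].
    by exists 0, 1; split; [lia|rewrite /apery_term /= mul1n].
  exists i, 0; split; first lia.
  by rewrite /apery_term; case: eqP => [|_]; lia.
case=> i [k [lti ->]]; rewrite /apery_term; case: eqP => i0.
  exists [:: (k, a)]; rewrite big_seq1; split=> // p.
  by rewrite inE => /eqP -> /=; left.
exists [:: (1, h * a + i * d); (k, a)]; split.
  move=> p; rewrite !inE => /orP[] /eqP -> /=; last by left.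
  by right; exists i => //=; lia.
by rewrite big_cons big_seq1 mul1n.
Qed.

Definition gap_seq (a h d : nat) : seq nat :=
  [seq apery_term a h d i %% a + j * a |
     i <- iota 0 a, j <- iota 0 (apery_term a h d i %/ a)].

Lemma gap_seqP (a h d n : nat) : reflect
  (exists i j, [/\ i < a, j < apery_term a h d i %/ a
                        & n = apery_term a h d i %% a + j * a])
  (n \in gap_seq a h d).
Proof.
apply: (iffP allpairsPdep) => [[i [j]]|[i [j]]]; rewrite ?mem_iota ?add0n.
  by case=> lti ltj ->; exists i, j.
by case=> lti ltj ->; exists i, j; rewrite !mem_iota.
Qed.

Lemma gap_seq_notin (a h d n : nat) : coprime a d -> 0 < a ->
  (n \in gap_seq a h d) = ~~ `[< apery_span a h d n >].
Proof.
move=> cad a0; apply/gap_seqP/asboolPn.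
  case=> i [j [lti ltj ->]] [l [k [ltl E]]].
  have il : i = l.
    apply: (@apery_term_modI a h d) => //.
    by rewrite -[LHS]modn_mod -(modnMDl j) addnC E addnC modnMDl.
  move: E; rewrite -il {2}(divn_eq (apery_term a h d i) a); nia.
move=> nS; have [i lti E] := @apery_term_surj a h d n cad a0.
exists i, (n %/ a); rewrite E addnC -divn_eq; split=> //.
rewrite ltnNge; apply/negP => le_wn; apply: nS.
exists i, (n %/ a - apery_term a h d i %/ a).
split=> //; rewrite {1}(divn_eq n a) {1}(divn_eq (apery_term a h d i) a) E.
by rewrite mulnBl addnAC subnKC // leq_mul2r le_wn orbT.
Qed.

Lemma gap_seq_uniq (a h d : nat) : coprime a d -> uniq (gap_seq a h d).
Proof.
move=> cad; apply: allpairs_uniq_dep => [||[i j] [k l]]; rewrite ?iota_uniq //.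
  by move=> ? _; rewrite iota_uniq.
move=> /allpairsPdep[i' [j' [lti ltj [-> ->]]]].
move=> /allpairsPdep[k' [l' [ltk ltl [-> ->]]]] /= E.
rewrite !mem_iota in lti ltk; have ik : i' = k'.
  apply: (@apery_term_modI a h d) => //.
  by rewrite -[LHS]modn_mod -[RHS]modn_mod -(modnMDl j') addnC E addnC modnMDl.
move: E; rewrite -ik => /addnI/eqP; rewrite eqn_mul2r => /orP[|/eqP -> //].
by case: (a) lti.
Qed.

(** For fixed [i] the sum over [j] telescopes along the progression from w_i mod a up to w_i. By
    [apery_term_residues] the starting points run once through 0, ..., a - 1. *)
Lemma sum_gap_seq_shift (V : zmodType) (a h d : nat) (f : nat -> V) :
  coprime a d ->
  (\sum_(n <- gap_seq a h d) (f n - f (n + a)%N) =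
   \sum_(i <- iota 0 a) f i - \sum_(i <- iota 0 a) f (apery_term a h d i))%R.
Proof.
move=> cad; have -> : (\sum_(i <- iota 0 a) f i =
    \sum_(i <- iota 0 a) f (apery_term a h d i %% a)%N)%R.
  by rewrite -(perm_big _ (apery_term_residues h cad)) big_map.
rewrite -sumrB big_allpairs_dep; apply: eq_bigr => i _.
pose g j := f (apery_term a h d i %% a + j * a).
have -> : f (apery_term a h d i) = g (apery_term a h d i %/ a).
  by rewrite /g addnC -divn_eq.
have -> : f (apery_term a h d i %% a) = g 0 by rewrite /g addn0.
rewrite -[RHS]opprB -telescope_sumr // -sumrN /index_iota subn0.
by apply: eq_bigr => j _; rewrite opprB /g mulSn [(a + _)%N]addnC addnA.
Qed.

(** * Arithmetic Apery sets *)

Lemma numerical_semigroup_addM (S : set nat) (a n k : nat) :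
  numerical_semigroup S -> S a -> S n -> S (n + k * a).
Proof.
move=> [_ SD _] Sa Sn; elim: k => [|k IHk]; first by rewrite addn0.
by rewrite mulSn addnCA addnC; apply: SD.
Qed.

(** If n < s in the same class, then s - a = n + k a for some k >= 0, so s - a would lie in [S]. *)
Lemma Apery_min (S : set nat) (a s n : nat) :
  numerical_semigroup S -> S a -> 0 < a -> Apery S a s -> S n ->
  n = s %[mod a] -> s <= n.
Proof.
move=> SS Sa a0 [Ss Na] Sn E; rewrite leqNgt; apply/negP => ltn.
have [[|k] Es] := eqmod_le_addM (ltnW ltn) (esym E); first by lia.
apply: Na; rewrite Es mulSn addnCA; split; first exact: leq_addr.
by rewrite addKn; apply: numerical_semigroup_addM.
Qed.

Lemma Apery_modI (S : set nat) (a s t : nat) :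
  numerical_semigroup S -> S a -> 0 < a -> Apery S a s -> Apery S a t ->
  s = t %[mod a] -> s = t.
Proof.
move=> SS Sa a0 As At E; apply/eqP; rewrite eqn_leq.
by rewrite (Apery_min SS Sa a0 As At.1) // (Apery_min SS Sa a0 At As.1).
Qed.

Lemma Apery_decomp (S : set nat) (a n : nat) : 0 < a -> S n ->
  exists s k, Apery S a s /\ n = s + k * a.
Proof.
move=> a0; elim/ltn_ind: n => n IHn Sn.
have [[le_an Sna]|An] := pselect (a <= n /\ S (n - a)); last first.
  by exists n, 0; rewrite addn0.
have [|s [k [As E]]] := IHn (n - a) _ Sna; first by lia.
by exists s, k.+1; split=> //; rewrite mulSn addnCA -E subnKC.
Qed.

(** Three facts are needed: [delta] is prime to [a], [a] divides [beta], and [beta] is nonnegative.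
    They come from Apery elements being the least elements of distinct classes modulo [a]; for a = 2
    the convention supplies the first and the third. *)
Lemma Apery_arithmetic_representation
    (S : set nat) (a : nat) (beta : int) (delta : nat) :
  numerical_semigroup S -> S a -> 0 < a ->
  Apery_arithmetic S a beta delta -> Apery S a `\ 0 !=set0 ->
  exists h d : nat,
    [/\ representation S a h d, beta = Posz (h * a) & delta = d].
Proof.
move=> SS Sa a0 [d1 a2P HA] [x0 Hx0].
have S0 : S 0 by case: SS.
have A0 : Apery S a 0 by split=> // -[]; lia.
have AP i : 1 <= i <= a - 1 ->
    exists2 s, (Apery S a `\ 0) s & Posz s = (beta + Posz (i * delta))%R.
  move=> hi; have : [set Posz s | s in Apery S a `\ 0]
      (beta + Posz (i * delta))%R by rewrite HA; exists i.
  by case=> s ? ?; exists s.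
have PA s : (Apery S a `\ 0) s ->
    exists2 i, 1 <= i <= a - 1 & Posz s = (beta + Posz (i * delta))%R.
  move=> As; have : [set Posz s | s in Apery S a `\ 0] (Posz s) by exists s.
  by rewrite HA => -[i hi <-]; exists i.
have a2 : 2 <= a by have [i hi _] := PA _ Hx0; lia.
have nz s : (Apery S a `\ 0) s -> s %% a <> 0.
  move=> [As s0] E; apply: s0 => /=.
  by apply: (Apery_modI SS Sa a0 As A0); rewrite E mod0n.
have cad : coprime a delta.
  have [E2|na2] := eqVneq a 2.
    by rewrite E2 coprime2n; case: (a2P E2).
  rewrite /coprime; apply/negPn/negP => g1.
  have g2 : 2 <= gcdn a delta by have := gcdn_gt0 a delta; lia.
  set g := gcdn a delta in g1 g2.
  have /dvdnP[b Eb] : g %| a by apply: dvdn_gcdl.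
  have /dvdnP[e Ee] : g %| delta by apply: dvdn_gcdr.
  (* With b = a / g, the terms of index 1 and 1 + b differ by b delta = e a, a multiple of [a], yet
     they are distinct. Here 1 + b <= a - 1 because a >= 3 and g >= 2. *)
  have [s1 As1 E1] := AP 1 ltac:(lia).
  have [s2 As2 E2] := AP (1 + b) ltac:(nia).
  have E12 : s2 = s1 + e * a.
    have -> : e * a = b * delta by rewrite Eb Ee; ring.
    by move: E1 E2; rewrite mulnDl; lia.
  have : s1 = s2 by apply: (Apery_modI SS Sa a0 As1.1 As2.1);
    rewrite E12 addnC modnMDl.
  nia.
have hD : (a %| beta)%Z.
  apply/negPn/negP => nD.
  pose r := `|(beta %% a)%Z|.
  have Er : Posz r = (beta %% a)%Z by rewrite /r gez0_abs // modz_ge0 //; lia.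
  (* With h = 0 the term is [i * delta]. Choosing it congruent to -beta modulo [a] makes beta + i
     delta a nonzero Apery element divisible by [a], against [nz]. *)
  have [i lti Ei] := @apery_term_surj a 0 delta (a - r) cad a0.
  have r0 : 0 < r.
    by rewrite lt0n; apply: contra nD => /eqP r0;
      apply/dvdz_mod0P; rewrite -Er r0.
  have ra : r < a by rewrite -ltz_nat Er ltz_pmod; lia.
  have i0 : i != 0.
    apply/eqP => i0; move: Ei; rewrite i0 /apery_term /= mod0n modn_small; lia.
  have [s As Es] := AP i ltac:(lia).
  apply: (nz _ As); apply/eqP; rewrite -[_ == 0]/(a %| s).
  have /dvdnP[t Et] : a %| i * delta + r.
    move: Ei; rewrite /apery_term (negPf i0) mul0n add0n => /eqP.
    by rewrite -(eqn_modDr r) subnK ?(ltnW ra) // modnn.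
  suff : (a %| Posz s)%Z by [].
  apply/dvdzP; exists ((beta %/ a)%Z + Posz t)%R.
  by rewrite Es mulrDl -PoszM -Et {1}(divz_eq beta a) -Er -addrA PoszD
    [(Posz r + _)%R]addrC.
have h0 : (0 <= beta)%R.
  have [E2|na2] := eqVneq a 2; first by case: (a2P E2) => ->.
  have [s1 As1 E1] := AP 1 ltac:(lia).
  have [s2 As2 E2] := AP 2 ltac:(lia).
  have [q Eq] : exists q, beta = (- Posz (q * a))%R \/ beta = Posz (q * a).
    by case/dvdzP: hD => -[] q ->; 
      [exists q; right | exists q.+1; left; rewrite NegzE mulNr]; rewrite PoszM.
  case: Eq => Eq; last by lia.
  (* Twice the first term is congruent to the second, which is least in its class: beta + 2 delta <=
     2 beta + 2 delta. *)
  suff : s2 <= s1 + s1 by lia.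
  apply: (Apery_min SS Sa a0 As2.1).
    by case: SS => _ SD _; apply: SD; apply: As1.1.1.
  by rewrite -(modnMDl q (s1 + s1)); congr (_ %% _); lia.
have [h Eh] : exists h, beta = Posz (h * a).
  case/dvdzP: hD => q Eq; exists `|q|; nia.
exists h, delta; split=> //; split=> //.
  by move=> /a2P[b0 ?]; split=> //; nia.
rewrite semigroup_gen_apery //; apply/seteqP; split=> n.
  move=> Sn; have [s [k [As ->]]] := Apery_decomp a0 Sn.
  have [-> |/eqP s0] := eqVneq s 0; first by exists 0, k.
  have [i hi Es] := PA s (conj As s0).
  exists i, k; split; first by lia.
  by rewrite /apery_term; case: eqP => [|_]; lia.
case=> i [k [lti ->]]; apply: numerical_semigroup_addM => //.
rewrite /apery_term; case: eqP => // i0.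
have [s As Es] := AP i ltac:(lia).
have <- : s = h * a + i * delta by lia.
exact: As.1.1.
Qed.

(** * Equidistribution and sums over residues *)

Lemma card_eq_seq (T : choiceType) (s t : seq T) : uniq s -> uniq t ->
  ([set` s] #= [set` t])%card <-> size s = size t.
Proof.
have card_seq (u : seq T) : uniq u -> ([set` u] #= `I_(size u))%card.
  move=> Uu; have -> : [set` u] = [set` [fset x in u]%fset].
    by apply/seteqP; split=> x /=; rewrite inE.
  by apply/card_eq_fsetP; rewrite card_fseq undup_id.
move=> /card_seq Cs /card_seq Ct; rewrite (card_eql Cs) (card_eqr Ct).
by split=> [/card_eq_II|->].
Qed.

Lemma eqr_Zp (m x y : nat) : 1 < m ->
  (x%:R == y%:R :> 'Z_m)%R = (x == y %[mod m]).
Proof. by move=> m1; rewrite -val_eqE /= !val_Zp_nat. Qed.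

(** The values are integers because differences of counts will be taken. *)
Definition residue_count (R : nzRingType) (s : seq nat) (c : R) : int :=
  (\sum_(n <- s) ((n%:R == c) : nat)%:Z)%R.

Lemma residue_countE (R : nzRingType) (s : seq nat) (c : R) :
  residue_count s c = Posz (count (fun n => n%:R == c)%R s).
Proof.
rewrite /residue_count; elim: s => [|n s IHs]; first by rewrite big_nil.
by rewrite big_cons IHs.
Qed.

Lemma equidistributed_seq (m : nat) (s : seq nat) : 1 < m -> uniq s ->
  equidistributed m [set` s] <->
  forall c : 'Z_m, residue_count s c = residue_count s (0 : 'Z_m)%R.
Proof.
move=> m1 Us; have cE r : [set` s] `&` [set n | n = r %[mod m]] =
    [set` [seq n <- s | n%:R == r%:R :> 'Z_m]%R].
  apply/seteqP; split=> n /=; rewrite mem_filter eqr_Zp //.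
    by case=> sn /eqP ->.
  by case/andP=> /eqP.
have eC r t : ([set` s] `&` [set n | n = r %[mod m]] #=
               [set` s] `&` [set n | n = t %[mod m]])%card <->
    residue_count s (r%:R : 'Z_m)%R = residue_count s (t%:R : 'Z_m)%R.
  rewrite !cE card_eq_seq ?filter_uniq // !size_filter !residue_countE.
  by split=> [->|[]].
split=> [H c|H r t]; last by apply/eC; rewrite !H.
by rewrite -[c]natr_Zp -[0%R]/(0%:R)%R; apply/eC/H.
Qed.

Lemma perm_eq_sum (T : eqType) (s t : seq T) :
  (forall c, \sum_(x <- s) ((x == c) : nat)%:Z =
             \sum_(x <- t) ((x == c) : nat)%:Z)%R -> perm_eq s t.
Proof.
move=> H; have E (u : seq T) c :
    (\sum_(x <- u) ((x == c) : nat)%:Z)%R = Posz (count_mem c u).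
  by elim: u => [|x u IHu]; rewrite ?big_nil // big_cons IHu.
by apply/allP => c _ /=; have := H c; rewrite !E => -[->].
Qed.

(** A unit generates the additive group: [c] is reached from 0 in c / u steps of length [u]. *)
Lemma Zp_shift_const (m : nat) (V : Type) (u : 'Z_m) (E : 'Z_m -> V) :
  (u \is a GRing.unit)%R -> (forall c, E (c - u)%R = E c) ->
  forall c, E c = E 0%R.
Proof.
move=> Uu Eu c; have Eu' n x : E (x - u *+ n)%R = E x.
  elim: n => [|n IHn]; first by rewrite subr0.
  by rewrite mulrSr opprD addrA Eu.
rewrite -(Eu' (val (c / u)%R) c); congr E.
by rewrite -mulr_natl natr_Zp divrK // subrr.
Qed.

(** The difference with step [u] is invariant under [v], hence constant; its total is 0, so it
    vanishes. Then [E] is itself constant with total 0. *)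
Lemma Zp_double_shift_zero (m : nat) (u v : 'Z_m) (E : 'Z_m -> int) :
  (u \is a GRing.unit)%R -> (v \is a GRing.unit)%R ->
  (\sum_c E c = 0)%R ->
  (forall c, E c - E (c - u) - E (c - v) + E (c - v - u) = 0)%R ->
  forall c, E c = 0%R.
Proof.
move=> Uu Uv E0 H.
have Du c : (E c - E (c - u) = E 0 - E (0 - u))%R.
  apply: (@Zp_shift_const m int v (fun c => E c - E (c - u))%R) => // x.
  by apply/eqP; rewrite -subr_eq0 -oppr_eq0; apply/eqP;
    rewrite -[RHS](H x); ring.
have sum_const (k : int) : (\sum_(c : 'Z_m) k = k *+ (Zp_trunc m).+2)%R.
  by rewrite sumr_const card_ord.
have reidx : (\sum_c E (c - u) = \sum_c E c)%R.
  by rewrite [RHS](reindex_inj (addIr (- u)%R)).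
have D0 : (E 0 - E (0 - u) = 0)%R.
  have : (\sum_c (E c - E (c - u)) = 0)%R by rewrite sumrB reidx subrr.
  rewrite (eq_bigr (fun=> E 0 - E (0 - u))%R) => [|c _]; last exact: Du.
  by rewrite sum_const => /eqP; rewrite Num.Theory.mulrn_eq0 => /eqP.
have Ec : forall c, E c = E 0%R.
  by apply: (Zp_shift_const Uu) => c; apply/esym/eqP; rewrite -subr_eq0 Du D0.
move=> c; rewrite Ec; move: E0; rewrite (eq_bigr (fun=> E 0%R)) => [|i _] //.
by rewrite sum_const => /eqP; rewrite Num.Theory.mulrn_eq0 => /eqP.
Qed.

(** * Comparison of the Apery set with an interval *)

Lemma four_terms_perm (R : comUnitRingType) (a d h : R) :
  (a \is a GRing.unit)%R -> (d \is a GRing.unit)%R ->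
  (perm_eq [:: 1; a + d; h * a + d + 1; h * a + a * d]
           [:: a; d + 1; h * a + d; h * a + a * d + 1] <->
   [\/ a = 1, a = 2%:R /\ 2%:R * h + d = 1, d = 1 /\ h = 0
     | d + 1 = 0 /\ h = 1])%R.
Proof.
move=> Ua Ud.
have d0 : d = 0%R -> False by move=> d0; move: Ud; rewrite d0 unitr0.
have a0 x : (a * x = 0)%R -> x = 0%R.
  by move=> ax; apply: (mulrI Ua); rewrite mulr0.
split=> [P|].
  have : (1 \in [:: a; d + 1; h * a + d; h * a + a * d + 1])%R.
    by rewrite -(perm_mem P) mem_head.
  rewrite !inE => /or4P[] /eqP E1.
  - by constructor 1.
  - by case: d0; apply: (addIr 1%R); rewrite add0r -E1.
  (* Here 1 = ha + d. Common entries are cancelled by comparing counts, then a + d is located, and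
     finally ha + d + 1 = 2, which equals [a] (second case) or d + 1 (third case). *)
  - have P2 : perm_eq [:: a + d; h * a + d + 1; h * a + a * d]%R
        [:: a; d + 1; h * a + a * d + 1]%R.
      by apply/permP => q; move/permP: P => /(_ q) /=; rewrite -E1; lia.
    have : (a + d \in [:: a; d + 1; h * a + a * d + 1])%R.
      by rewrite -(perm_mem P2) mem_head.
    rewrite !inE => /or3P[] /eqP E2.
    + by case: d0; apply: (addrI a); rewrite addr0.
    + by constructor 1; apply: (addrI d); rewrite addrC.
    have P3 : perm_eq [:: h * a + d + 1; h * a + a * d]%R [:: a; d + 1]%R.
      by apply/permP => q; move/permP: P2 => /(_ q) /=; rewrite -E2; lia.
    have : (h * a + d + 1 \in [:: a; d + 1])%R.
      by rewrite -(perm_mem P3) mem_head.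
    rewrite -E1 !inE => /orP[] /eqP E3.
      constructor 2; split; first by rewrite -E3.
      by rewrite [RHS]E1 -E3; ring.
    have Ed : d = 1%R by apply: (addIr 1%R).
    constructor 3; split=> //; apply: a0.
    by apply: (addIr d); rewrite add0r mulrC -E1.
  (* Here 1 = ha + ad + 1, so a(h + d) = 0. Locating a + d then gives a = 1 or ha = a, and the
     latter yields a(d + 1) = 0. *)
  - have hd : h = (- d)%R.
      apply/eqP; rewrite -addr_eq0; apply/eqP/a0; apply: (addIr 1%R).
      by rewrite add0r [RHS]E1; ring.
    have P2 : perm_eq [:: a + d; h * a + d + 1; h * a + a * d]%R
        [:: a; d + 1; h * a + d]%R.
      by apply/permP => q; move/permP: P => /(_ q) /=; rewrite -E1; lia.
    have : (a + d \in [:: a; d + 1; h * a + d])%R.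
      by rewrite -(perm_mem P2) mem_head.
    rewrite !inE => /or3P[] /eqP E2.
    + by case: d0; apply: (addrI a); rewrite addr0.
    + by constructor 1; apply: (addrI d); rewrite addrC.
    have Ed : (d + 1 = 0)%R.
      apply: a0; apply: (addrI (h * a + d)%R); rewrite addr0 -[RHS]E2 hd; ring.
    by constructor 4; split=> //; rewrite hd; apply/eqP;
      rewrite eq_sym -addr_eq0 addrC Ed.
case=> [a1|[a2 hd]|[d1 h0]|[d1 h1]]; apply/permP => q /=.
- have -> : (h * a + a * d = h * a + d)%R by rewrite a1; ring.
  rewrite a1 [(1 + d)%R]addrC; ring.
- have -> : (h * a + d = 1)%R by rewrite -hd a2; ring.
  have -> : (h * a + a * d = d + 1)%R by rewrite -hd a2; ring.
  have -> : (a + d = d + 1 + 1)%R by rewrite a2; ring.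
  have -> : (1 + 1 = a)%R by rewrite a2.
  ring.
- rewrite h0 d1 !mul0r !add0r mulr1; ring.
- have -> : (d = -1)%R by apply/eqP; rewrite -addr_eq0 d1.
  rewrite h1 !mul1r addrNK mulrN1 subrr addNr add0r; ring.
Qed.

(** This is the telescoping identity for the indicator of [c]: n + a is in the class [c] exactly
    when n is in the class c - a. *)
Lemma residue_count_gap_seq (m a h d : nat) (c : 'Z_m) : coprime a d ->
  (residue_count (gap_seq a h d) c - residue_count (gap_seq a h d) (c - a%:R) =
   residue_count (iota 0 a) c -
   residue_count [seq apery_term a h d i | i <- iota 0 a] c)%R.
Proof.
move=> cad; rewrite /residue_count big_map.
rewrite -(sum_gap_seq_shift _ (fun n => ((n%:R == c) : nat)%:Z)%R cad) sumrB.
by congr (_ - _)%R; apply: eq_bigr => n _; rewrite natrD eq_sym subr_eq eq_sym.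
Qed.

(** Constant counts make the left side of [residue_count_gap_seq] vanish. Conversely, equal
    multisets make the count invariant under the shift by the unit [a], hence constant. *)
Lemma equidistributed_gap_seq (m a h d : nat) :
  1 < m -> coprime a d -> coprime a m ->
  equidistributed m [set` gap_seq a h d] <->
  perm_eq [seq i%:R : 'Z_m | i <- iota 0 a]%R
          [seq (apery_term a h d i)%:R | i <- iota 0 a]%R.
Proof.
move=> m1 cad cam; rewrite equidistributed_seq ?gap_seq_uniq //.
have Ua : (a%:R : 'Z_m)%R \is a GRing.unit by rewrite unitZpE // coprime_sym.
split=> [H|P].
  apply: perm_eq_sum => c; rewrite !big_map; apply/eqP; rewrite -subr_eq0.
  have := residue_count_gap_seq h c cad; rewrite !H subrr.
  by rewrite /residue_count big_map => <-.
apply: (Zp_shift_const Ua) => c; apply/esym/eqP; rewrite -subr_eq0.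
rewrite residue_count_gap_seq // /residue_count big_map.
have := perm_big (op := +%R) (x := 0%R) _ P (P := xpredT)
  (F := fun x => Posz (x == c)).
by rewrite !big_map => ->; rewrite subrr.
Qed.

(** The function [g] is a difference with steps 1 and d. Its sum over 0, ..., a - 1 telescopes
    through step 1, and its sum over w_1, ..., w_(a-1) through step d. The term w_0 = 0 contributes
    [g 0] apart, and the values f 0 and f d cancel. *)
Lemma apery_double_difference (R : comNzRingType) (a h d : nat)
    (f : R -> int) :
  0 < a ->
  let g x := (f x - f (x + 1) - f (x + d%:R) + f (x + d%:R + 1))%R in
  (\sum_(i <- iota 0 a) g i%:R - \sum_(i <- iota 0 a) g (apery_term a h d i)%:R
   = \sum_(x <- [:: 1; a%:R + d%:R; h%:R * a%:R + d%:R + 1;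
                    h%:R * a%:R + a%:R * d%:R]) f x
     - \sum_(x <- [:: a%:R; d%:R + 1; h%:R * a%:R + d%:R;
                      h%:R * a%:R + a%:R * d%:R + 1]) f x)%R.
Proof.
case: a => // a _ g.
pose u n := (f (n%:R + d%:R) - f n%:R)%R.
have -> : (\sum_(i <- iota 0 a.+1) g i%:R = u a.+1 - u 0)%R.
  rewrite -telescope_sumr // /index_iota subn0; apply: eq_bigr => i _.
  rewrite /g /u -natr1 [(i%:R + 1 + d%:R)%R]addrAC; ring.
pose v i := (f (h%:R * a.+1%:R + i%:R * d%:R + 1)
             - f (h%:R * a.+1%:R + i%:R * d%:R))%R.
have -> : (\sum_(i <- iota 0 a.+1) g (apery_term a.+1 h d i)%:R =
           g 0%R + (v a.+1 - v 1))%R.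
  rewrite [iota _ _]/= big_cons; congr (_ + _)%R.
  rewrite -telescope_sumr // /index_iota subSS subn0 big_seq [RHS]big_seq.
  apply: eq_bigr => i; rewrite mem_iota => /andP[i1 _].
  rewrite /apery_term eqn0Ngt i1 /= /g /v natrD !natrM -(natr1 i) mulrDl mul1r.
  rewrite !addrA; ring.
rewrite !big_cons !big_nil /g /u /v !add0r mul1r.
ring.
Qed.

Lemma perm_eq_apery_four_terms (m a h d : nat) :
  0 < a -> (d%:R : 'Z_m)%R \is a GRing.unit ->
  perm_eq [seq i%:R : 'Z_m | i <- iota 0 a]%R
          [seq (apery_term a h d i)%:R | i <- iota 0 a]%R <->
  perm_eq [:: 1; a%:R + d%:R; h%:R * a%:R + d%:R + 1;
              h%:R * a%:R + a%:R * d%:R : 'Z_m]%R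
          [:: a%:R; d%:R + 1; h%:R * a%:R + d%:R;
              h%:R * a%:R + a%:R * d%:R + 1]%R.
Proof.
move=> a0 Ud; have DD := @apery_double_difference 'Z_m a h d _ a0.
split=> P; apply: perm_eq_sum => c.
  apply/eqP; rewrite -subr_eq0 -(DD (fun x => Posz (x == c))) /=.
  pose g x := (Posz (x == c) - Posz (x + 1 == c) - Posz (x + d%:R == c)
               + Posz (x + d%:R + 1 == c))%R.
  have := perm_big (op := +%R) (x := 0%R) _ P (P := xpredT) (F := g).
  by rewrite !big_map => ->; rewrite subrr.
(* [E] is the difference of the multiplicities of [c]. Its total is a - a = 0, and its double
   difference is the comparison of the four-term lists. *)
pose E c := (\sum_(i <- iota 0 a) Posz (i%:R == c :> 'Z_m)
             - \sum_(i <- iota 0 a) Posz ((apery_term a h d i)%:R == c))%R.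
rewrite !big_map; apply/eqP; rewrite -subr_eq0; apply/eqP.
apply: (@Zp_double_shift_zero m 1%R d%:R%R E) => [|||x];
  [exact: unitr1|by []| |].
  have sum1 (n : nat) : (\sum_c Posz (n%:R == c :> 'Z_m) = 1)%R.
    by rewrite (bigD1 n%:R)%R //= eqxx big1 ?addr0 // => y;
      rewrite eq_sym => /negPf->.
  rewrite /E sumrB exchange_big [X in (_ - X)%R]exchange_big /=.
  under eq_bigr do rewrite sum1.
  by under [X in (_ - X)%R]eq_bigr do rewrite sum1; rewrite subrr.
have := DD (fun y => Posz (y == x)).
have := perm_big (op := +%R) (x := 0%R) _ P (P := xpredT)
  (F := fun y => Posz (y == x)).
rewrite /= => ->; rewrite subrr => <-.
have Eu u : (E (x - u) = \sum_(i <- iota 0 a) Posz (i%:R + u == x)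
    - \sum_(i <- iota 0 a) Posz ((apery_term a h d i)%:R + u == x))%R.
  by congr (_ - _)%R; apply: eq_bigr => i _; rewrite eq_sym subr_eq eq_sym.
have -> : (E (x - d%:R - 1) = \sum_(i <- iota 0 a) Posz (i%:R + d%:R + 1 == x)
    - \sum_(i <- iota 0 a) Posz ((apery_term a h d i)%:R + d%:R + 1 == x))%R.
  by congr (_ - _)%R; apply: eq_bigr => i _;
    rewrite eq_sym !subr_eq eq_sym addrAC.
rewrite !Eu /E !big_split /= !sumrN; ring.
Qed.

Lemma perm_eq_apery_modn (m g a h d : nat) : 1 < m -> g %| m ->
  perm_eq [seq i%:R : 'Z_m | i <- iota 0 a]%R
          [seq (apery_term a h d i)%:R | i <- iota 0 a]%R ->
  perm_eq [seq i %% g | i <- iota 0 a]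
          [seq apery_term a h d i %% g | i <- iota 0 a].
Proof.
move=> m1 gm /(perm_map (fun x : 'Z_m => x %% g)); rewrite -!map_comp.
by congr perm_eq; apply: eq_map => i /=; rewrite val_Zp_nat // modn_dvdm.
Qed.

(** Modulo g = gcd(d, m) > 1 every w_i with i > 0 is ha, so 0, ..., a - 1 take only the residues 0
    and ha. The number 1 forces ha = 1, hence a > 2, and then the number 2 forces g = 2. *)
Lemma perm_eq_apery_coprime (m a h d : nat) : 1 < m -> 2 <= a ->
  (a = 2 -> h = 0) ->
  perm_eq [seq i%:R : 'Z_m | i <- iota 0 a]%R
          [seq (apery_term a h d i)%:R | i <- iota 0 a]%R ->
  coprime d m.
Proof.
move=> m1 a2 h2 P; rewrite /coprime; apply/negPn/negP => g1.
have g2 : 1 < gcdn d m by have := gcdn_gt0 d m; lia.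
have {P} := perm_eq_apery_modn m1 (dvdn_gcdr d m) P.
have gd := dvdn_gcdl d m; move: (gcdn d m) g2 gd => g g2 gd {g1} P.
have Et i : apery_term a h d i %% g = (0 < i) * (h * a %% g).
  case: i => [|i]; first by rewrite mod0n.
  rewrite /apery_term /= mul1n -modnDmr.
  by have /eqP -> := dvdn_mull i.+1 gd; rewrite addn0.
have res n : n < a -> n %% g = 0 \/ n %% g = h * a %% g.
  move=> lta; have : n %% g \in [seq i %% g | i <- iota 0 a].
    by apply: map_f; rewrite mem_iota.
  rewrite (perm_mem P) => /mapP[i _ ->]; rewrite Et.
  by case: i => [|i]; [left|right]; rewrite ?mul0n ?mul1n.
have E1 : h * a %% g = 1 by case: (res 1 a2); rewrite modn_small.
have a3 : 2 < a.
  by rewrite ltn_neqAle a2 andbT; apply/eqP => E; move: E1; rewrite h2 // mod0n.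
have E2 : g = 2.
  have [lg|lg] := ltnP 2 g; last by lia.
  by case: (res 2 a3); rewrite modn_small // E1.
(* Modulo 2 the residue 0 occurs at both 0 and 2 among the numbers below [a], but only at i = 0
   among the w_i. *)
move/permP: P => /(_ (pred1 0)).
have -> : [seq apery_term a h d i %% g | i <- iota 0 a] =
    [seq ((0 < i) : nat) | i <- iota 0 a].
  by apply: eq_map => i; rewrite Et E1 muln1.
have -> : iota 0 a = [:: 0, 1, 2 & iota 3 (a - 3)]
  by rewrite -{1}(subnK a3) addnC.
have Z : count_mem 0 [seq ((0 < i) : nat) | i <- iota 3 (a - 3)] = 0.
  rewrite (@eq_in_count _ _ pred0) ?count_pred0 // => x /mapP[i].
  by rewrite mem_iota => /andP[i3 _] -> /=; rewrite (ltn_trans _ i3).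
by rewrite /= E2 Z.
Qed.

(** * Coprimality of a and m *)

(** Let e_j = k(j + 1) - k(j). As g divides [a], the last term on the right is k(a - 1), the sum of
    all e_j. The equation then says that the e_j with g dividing j + 1 already have this sum, so the
    other ones, being nonnegative, vanish. *)
Lemma const_off_multiples (k : nat -> nat) (a g : nat) :
  k 0 = 0 -> {homo k : i j / i <= j} -> g %| a -> 0 < a ->
  \sum_(i <- iota 0 a) k i * (g %| i) =
    \sum_(i <- iota 0 a) k i * (g %| i.+1) ->
  forall i, i.+1 < a -> ~~ (g %| i.+1) -> k i.+1 = k i.
Proof.
move=> k0 kmono ga; case: a ga => // a ga _ E i lti ndvd.
pose e i := k i.+1 - k i.
have ke j : k j.+1 = k j + e j by rewrite subnKC // kmono.
have ka : k a = \sum_(0 <= j < a) e j.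
  elim: (a) => [|b IHb]; first by rewrite big_geq.
  by rewrite big_nat_recr //= -IHb ke.
move: E; have iotaE : iota 0 a.+1 = index_iota 0 a.+1
  by rewrite /index_iota subn0.
rewrite !iotaE big_nat_recl // big_nat_recr //= k0 mul0n add0n ga muln1 ka.
under eq_bigr do rewrite ke mulnDl.
rewrite big_split /= => /addnI E.
have : \sum_(0 <= j < a) e j * ~~ (g %| j.+1) = 0.
  apply/eqP; rewrite -(eqn_add2l (\sum_(0 <= j < a) e j * (g %| j.+1))) addn0.
  rewrite -big_split /= [X in _ == X]E; apply/eqP/eq_bigr => j _.
  by case: (_ %| _); rewrite ?muln0 ?muln1 ?addn0.
move/eqP; rewrite sum_nat_seq_eq0 => /allP/(_ i).
rewrite mem_index_iota ndvd muln1 /= => /(_ lti)/eqP ei.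
by rewrite ke ei addn0.
Qed.

(** Both sides equal the common residue count times the sum of [F] over ['Z_m], which a translation
    preserves. *)
Lemma equidistributed_sum (m : nat) (s : seq nat) (F : 'Z_m -> int) (u : 'Z_m) :
  1 < m -> uniq s -> equidistributed m [set` s] ->
  (\sum_(n <- s) F n%:R = \sum_(n <- s) F (n%:R + u))%R.
Proof.
move=> m1 Us /(equidistributed_seq m1 Us) H.
have sumF (G : 'Z_m -> int) :
    (\sum_(n <- s) G n%:R = (\sum_c G c) * residue_count s (0 : 'Z_m))%R.
  rewrite mulr_suml.
  transitivity (\sum_c G c * residue_count s c)%R;
    last by apply: eq_bigr => c _; rewrite H.
  under [RHS]eq_bigr do rewrite mulr_sumr.
  rewrite exchange_big; apply: eq_bigr => n _.
  rewrite (bigD1 (n%:R)%R) //= eqxx mulr1 big1 ?addr0 // => c.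
  by rewrite eq_sym => /negPf->; rewrite mulr0.
rewrite (sumF F) (sumF (fun x => F (x + u)%R)); congr (_ * _)%R.
exact: (reindex_inj (addIr u)).
Qed.

Lemma equidistributed_gap_seq_coprime (m a h d : nat) :
  1 < m -> 2 <= a -> 0 < d -> coprime a d -> gap_seq a h d != [::] ->
  equidistributed m [set` gap_seq a h d] -> coprime a m.
Proof.
move=> m1 a2 d0 cad gne H; rewrite /coprime; apply/negPn/negP => g1.
have g2 : 1 < gcdn a m by have := gcdn_gt0 a m; lia.
move: (dvdn_gcdl a m) (dvdn_gcdr a m) g2; move: (gcdn a m) => g ga gm g2 {g1}.
pose k i := apery_term a h d i %/ a.
have cgd : coprime g d by apply: coprime_dvdl ga cad.
(* Each of the [k i] gaps of index [i] is congruent to [i * d] modulo g, since g divides [a]; as g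
   is prime to [d], it divides n + e d exactly when it divides i + e. *)
have sum_k e : \sum_(n <- gap_seq a h d) (g %| n + e * d) =
    \sum_(i <- iota 0 a) k i * (g %| i + e).
  rewrite big_allpairs_dep; apply: eq_bigr => i _.
  rewrite (eq_bigr (fun=> (g %| i + e) : nat)) => [|j _].
    by rewrite big_const_seq count_predT size_iota iter_addn_0 mulnC.
  have E : apery_term a h d i %% a + j * a = i * d %[mod g].
    rewrite -(modn_dvdm _ ga) -[RHS](modn_dvdm _ ga); congr (_ %% _).
    by rewrite addnC modnMDl modn_mod apery_term_mod.
  congr nat_of_bool; rewrite -(Gauss_dvdl (i + e) cgd) mulnDl.
  by rewrite /dvdn -modnDml E modnDml.
have dvdZ n : (g %| (n%:R : 'Z_m)%R) = (g %| n).
  by rewrite val_Zp_nat // /dvdn modn_dvdm.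
have sumZ (s : seq nat) (F : nat -> nat) :
    (\sum_(n <- s) Posz (F n))%R = Posz (\sum_(n <- s) F n).
  by elim: s => [|n s IHs]; rewrite ?big_nil // !big_cons IHs.
have Ek : \sum_(i <- iota 0 a) k i * (g %| i) =
    \sum_(i <- iota 0 a) k i * (g %| i.+1).
  have : (\sum_(n <- gap_seq a h d) Posz (g %| (n%:R : 'Z_m)%R)%N =
          \sum_(n <- gap_seq a h d) Posz (g %| (n%:R + d%:R : 'Z_m)%R)%N)%R.
    exact: (equidistributed_sum (fun x : 'Z_m => Posz (g %| x)) _ m1
      (gap_seq_uniq h cad) H).
  rewrite (eq_bigr (fun n => Posz (g %| n + 0 * d))) => [|n _]; last first.
    by rewrite dvdZ addn0.
  rewrite [RHS](eq_bigr (fun n => Posz (g %| n + 1 * d))) => [|n _]; last first.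
    by rewrite -natrD dvdZ mul1n.
  rewrite !sumZ !sum_k => -[E].
  transitivity (\sum_(i <- iota 0 a) k i * (g %| i + 0)).
    by apply: eq_bigr => i _; rewrite addn0.
  by rewrite E; apply: eq_bigr => i _; rewrite addn1.
have k0 : k 0 = 0 by rewrite /k div0n.
have kmono : {homo k : i j / i <= j}.
  move=> i j le_ij; apply: leq_div2r; rewrite /apery_term.
  case: eqP => // i0; case: eqP => j0; first by lia.
  by rewrite leq_add2l leq_mul2r le_ij orbT.
have jump := const_off_multiples k0 kmono ga (ltnW a2) Ek.
(* Since g > 1 does not divide 1, there is no jump at 1, so ha + d < a. *)
have k1 : k 1 = 0 by rewrite jump // dvdn1; lia.
have lt_hd : h * a + 1 * d < a.
  rewrite ltnNge -divn_gt0; last by lia.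
  by rewrite -[_ %/ a]/(k 1) k1.
have h0 : h = 0 by nia.
have da : d < a by lia.
have kE i : k i = i * d %/ a by rewrite /k /apery_term h0; case: eqP => [->|].
have d2 : 1 < d.
  rewrite ltn_neqAle d0 andbT; apply: contra gne => /eqP d1.
  case E: (gap_seq a h d) => [//|n s].
  have /gap_seqP[i [j [lti]]] : n \in gap_seq a h d by rewrite E mem_head.
  by rewrite -/(k i) kE -d1 muln1 divn_small.
(* From q d < a < (q + 1) d, the first jump of floor(i d / a) is at q + 1; the symmetry exchanging i
   and a - i puts the last one at a - q. *)
pose q := a %/ d.
have qa : q * d < a.
  rewrite ltn_neqAle leq_divM andbT; apply/eqP => E.
  move: cad; rewrite -E /coprime gcdnC gcdnMl; lia.
have qa' : a < q.+1 * d by rewrite ltn_ceil.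
have q0 : 0 < q by rewrite divn_gt0 // ltnW.
have D1 : g %| q.+1.
  apply/negPn/negP => /jump; rewrite !kE [X in _ = X]divn_small // => E.
  have : 0 < q.+1 * d %/ a by rewrite divn_gt0; lia.
  by rewrite E //; nia.
have a0 : 0 < a by apply: ltnW.
have lt_qa : q < a by apply: leq_ltn_trans qa; rewrite leq_pmulr.
(* The index is a - q, written as a successor to fit [jump]; there the quotient passes from below d
   - 1 to at least d - 1. *)
have D2 : g %| (a - q.+1).+1.
  apply/negPn/negP => /jump; rewrite !kE => E.
  have : (a - q.+1) * d %/ a < d - 1.
    by rewrite ltn_divLR // !mulnBl mul1n [d * a]mulnC ltn_sub2l // ltn_Pmulr.
  have : d - 1 <= (a - q.+1).+1 * d %/ a.
    by rewrite leq_divRL // -subSn // subSS !mulnBl mul1n [d * a]mulnC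
      leq_sub2l // ltnW.
  rewrite E => [/leq_ltn_trans le /le|]; first by rewrite ltnn.
  by rewrite -subSn // subSS ltn_subrL q0.
have : g %| 1.
  have : g %| q.+1 + (a - q.+1).+1 by rewrite dvdn_add.
  have -> : q.+1 + (a - q.+1).+1 = a + 1 by rewrite addnS subnKC // addn1.
  by rewrite dvdn_addr.
by rewrite dvdn1 gtn_eqF.
Qed.

(** * The four cases *)

Lemma equidistributed1 (A : set nat) : equidistributed 1 A.
Proof.
move=> r t; suff -> : [set n | n = r %[mod 1]] = [set n | n = t %[mod 1]].
  exact: card_eqxx.
by apply/seteqP; split=> n /=; rewrite !modn1.
Qed.

Lemma gaps_apery_span (a h d : nat) : coprime a d -> 0 < a ->
  gaps (apery_span a h d) = [set` gap_seq a h d].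
Proof.
move=> cad a0; apply/seteqP; split=> n /=; rewrite gap_seq_notin //.
  by move=> nS; apply/asboolPn.
by move/asboolPn.
Qed.

Lemma Zp_four_cases (m a h d : nat) : 1 < m ->
  [\/ a%:R = 1 :> 'Z_m,
      a%:R = 2%:R :> 'Z_m /\ 2%:R * h%:R + d%:R = 1 :> 'Z_m,
      d%:R = 1 :> 'Z_m /\ h%:R = 0 :> 'Z_m
    | d%:R + 1 = 0 :> 'Z_m /\ h%:R = 1 :> 'Z_m]%R <->
  [\/ a = 1 %[mod m],
      a = 2 %[mod m] /\ 2 * h + d = 1 %[mod m],
      d = 1 %[mod m] /\ h = 0 %[mod m]
    | d + 1 = 0 %[mod m] /\ h = 1 %[mod m]].
Proof.
move=> m1.
have eqZ x y : (x = y %[mod m]) = (x%:R = y%:R :> 'Z_m)%R.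
  apply/propext; split=> [/eqP|/eqP]; first by rewrite -eqr_Zp // => /eqP.
  by rewrite eqr_Zp // => /eqP.
by rewrite !eqZ (natrD _ (2 * h) d) natrM (natrD _ d 1).
Qed.

Theorem corollary5p6 (S : set nat) (a m : nat) (beta : int) (delta : nat)
    (hS : numerical_semigroup S) (haS : S a) (ha : a <> 0) (hm : 0 < m)
    (harith : Apery_arithmetic S a beta delta)
    (hne : Apery S a `\ 0 !=set0) :
  (exists h d : nat,
     [/\ representation S a h d, beta = Posz (h * a) & delta = d]) /\
  (forall h d : nat, representation S a h d ->
     gaps S !=set0 ->
     (equidistributed m (gaps S) <->
      coprime (a * d) m /\
      [\/ a = 1 %[mod m],
          a = 2 %[mod m] /\ 2 * h + d = 1 %[mod m],
          d = 1 %[mod m] /\ h = 0 %[mod m]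
        | d + 1 = 0 %[mod m] /\ h = 1 %[mod m]])).
Proof.
have a0 : 0 < a by lia.
split; first exact: (Apery_arithmetic_representation hS haS a0 harith hne).
move=> h d [a2 d0 cad a2h]; rewrite semigroup_gen_apery // => -> [n].
(* The ring ['Z_m] models residues modulo [m] only for m > 1; for m = 1 both sides hold. *)
have [->|m1] : m = 1 \/ 1 < m by lia.
  rewrite coprimen1; split=> [_|_]; last exact: equidistributed1.
  by split=> //; constructor 1; rewrite !modn1.
rewrite gaps_apery_span // coprimeMl => gn.
have h0 : a = 2 -> h = 0 by case/a2h.
split=> [H|[/andP[cam cdm]]].
  (* The given gap makes the list nonempty; an empty set of gaps would be equidistributed for every
     [m]. *)
  have cam : coprime a m.
    by apply: (equidistributed_gap_seq_coprime m1 a2 d0 cad _ H);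
      case: gap_seq gn.
  have P := (equidistributed_gap_seq h m1 cad cam).1 H.
  have cdm := perm_eq_apery_coprime m1 a2 h0 P.
  rewrite cam cdm; split=> //; apply/Zp_four_cases => //.
  by apply/four_terms_perm/perm_eq_apery_four_terms;
    rewrite ?unitZpE // coprime_sym.
move/(Zp_four_cases _ _ _ m1) => C.
apply/equidistributed_gap_seq/perm_eq_apery_four_terms/four_terms_perm => //;
  by rewrite unitZpE // coprime_sym.
Qed.
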